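(* For every integer $n\ge 6$ with $n\equiv 2\pmod 4$ there exists a $5$-maxMOFS$(n)$, i.e. a set of $5$ pairwise orthogonal binary frequency squares of order $n$ such that no binary frequency square of order $n$ is orthogonal to all $5$ of them.
   Context: Let $N(n)=\{1,\dots,n\}$ and let $n$ be even. A (binary) frequency square of order $n$ is an $n\times n$ array indexed by $N(n)\times N(n)$ with entries in $\{0,1\}$ such that every row and every column contains exactly $n/2$ zeros and $n/2$ ones. Two frequency squares $F,G$ of order $n$ are orthogonal if for each $(a,b)\in\{0,1\}^2$ the number of cells $(r,c)$ with $(F[r,c],G[r,c])=(a,b)$ equals $n^2/4$. A $k$-MOFS$(n)$ is a set of $k$ pairwise orthogonal frequency squares of order $n$; it is maximal (a $k$-maxMOFS$(n)$) if there is no frequency square of order $n$ orthogonal to each of its members. *)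

(* Defs.v *)
From mathcomp Require Import all_boot all_order all_algebra.

Set Implicit Arguments.
Unset Strict Implicit.
Unset Printing Implicit Defensive.

(* Arrays are boolean matrices, with false and true standing for 0 and 1, and
   with rows and columns numbered from 0. Asking for the count n %/ 2 of both
   symbols in each line leaves no frequency square of odd order, so both
   n %/ 2 and n ^ 2 %/ 4 below are exact whenever they matter. *)
Definition frequency_square (n : nat) (F : 'M[bool]_n) : Prop :=
  (forall (r : 'I_n) (a : bool), #|[set c : 'I_n | F r c == a]| = n %/ 2) /\
  (forall (c : 'I_n) (a : bool), #|[set r : 'I_n | F r c == a]| = n %/ 2).

Definition fs_orthogonal (n : nat) (F G : 'M[bool]_n) : Prop :=
  forall a b : bool,
    #|[set rc : 'I_n * 'I_n | (F rc.1 rc.2 == a) && (G rc.1 rc.2 == b)]|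
      = n ^ 2 %/ 4.

Definition MOFS (k n : nat) (S : {set 'M[bool]_n}) : Prop :=
  [/\ #|S| = k,
      forall F, F \in S -> frequency_square F
    & forall F G, F \in S -> G \in S -> F <> G -> fs_orthogonal F G].

Definition maxMOFS (k n : nat) (S : {set 'M[bool]_n}) : Prop :=
  MOFS k S /\
  ~ (exists G : 'M[bool]_n,
       frequency_square G /\ forall F, F \in S -> fs_orthogonal F G).

(* Main.v *)
Require Import Defs.
From mathcomp Require Import all_boot all_order all_algebra zify.

(** Write n = 6 + 4t. The five squares are read off one 10 x 10 table, whose
    last four rows and columns are repeated t times; each of its blocks (6 x 6,
    6 x 4, 4 x 6, 4 x 4) is balanced in lines and in pairs of squares, so the
    blow-up is a 5-MOFS(n). In every cell (r, c) the sum of the five entries is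
    congruent mod 2 to [r in A] + [c in B], with |A| = 1 + 2t and |B| = 3 + 2t.
    If G were orthogonal to all five squares, counting the ones of G with this
    weight would give 5 n^2 / 4, which is odd; but it also gives, modulo 2,
    (|A| + |B|) n / 2, which is even. *)

(* Bit k of an entry is the corresponding entry of the k-th square. The table
   was found by simulated annealing, block by block. *)
Definition mofs_table : seq (seq nat) :=
  [:: [::  3; 18; 27; 28;  4; 13;   10; 23; 28;  1];
      [::  8;  7; 22;  9; 27; 20;    4; 25; 27;  6];
      [:: 31;  1;  8; 18;  5; 30;   13; 16;  3; 30];
      [:: 16; 25; 13; 23;  6; 10;   31;  2;  5; 24];
      [:: 21; 14;  2; 15; 24; 17;   19; 14; 20;  9];
      [:: 14; 28; 21;  0; 27;  3;   16; 13; 10; 23];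
      [:: 17; 18; 30;  8;  7; 13;   10; 23; 13; 16];
      [:: 15;  6;  0; 28; 25; 19;   20; 10; 25;  7];
      [::  4; 25; 31;  3; 10; 20;    1; 28;  6; 27];
      [:: 26; 13;  1; 23; 20; 10;   31;  1; 18; 12]].

Definition bit (k i j : nat) : bool :=
  odd (iter k half (nth 0 (nth [::] mofs_table i) j)).

Definition code (i : nat) : nat := if i < 6 then i else 6 + (i - 6) %% 4.

Definition head_sum (f : nat -> nat) : nat := sumn [seq f i | i <- iota 0 6].
Definition tail_sum (f : nat -> nat) : nat := sumn [seq f i | i <- iota 6 4].

(** The traces on the table of the sets A and B. Two of the four repeated lines lie in each class,
    which gives the sizes 1 + 2t and 3 + 2t. *)
Definition row_class (i : nat) : bool := i \in [:: 0; 6; 7].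
Definition col_class (j : nat) : bool := j \in [:: 0; 1; 2; 6; 7].

Lemma code_lt (i : nat) : code i < 10.
Proof. by rewrite /code; case: ifP => ?; lia. Qed.

Lemma code_tail (i : nat) : 6 <= i -> code i = 6 + (i - 6) %% 4.
Proof. by move=> le6i; rewrite /code ltnNge le6i. Qed.

(** The indices below 6 are fixed by [code], and each increment of [t] appends one full period 6, 7,
    8, 9. *)
Lemma sum_code (t : nat) (f : nat -> nat) :
  \sum_(i < 6 + 4 * t) f (code i) = head_sum f + t * tail_sum f.
Proof.
rewrite -(big_mkord xpredT (fun i => f (code i))).
elim: t => [|t IHt]; first by rewrite muln0 mul0n !addn0 unlock.
have -> : 6 + 4 * t.+1 = (6 + 4 * t).+4 by lia.
have step m : \sum_(0 <= i < m.+4) f (code i) = \sum_(0 <= i < m) f (code i)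
    + f (code m) + f (code m.+1) + f (code m.+2) + f (code m.+3).
  by rewrite !big_nat_recr.
rewrite step IHt mulSn /tail_sum /=.
have [-> -> -> ->] : [/\ code (6 + 4 * t) = 6, code (6 + 4 * t).+1 = 7,
    code (6 + 4 * t).+2 = 8 & code (6 + 4 * t).+3 = 9].
  by split; rewrite code_tail; lia.
lia.
Qed.

(** Boolean quantifiers, so that the finite checks on the table reduce to [true] by computation. *)
Definition all_below (m : nat) (P : pred nat) : bool := all P (iota 0 m).

Lemma all_belowP {m i : nat} {P : pred nat} : all_below m P -> i < m -> P i.
Proof. by move/allP => allP ltim; apply: allP; rewrite mem_iota. Qed.

Definition all_bool (P : pred bool) : bool := P false && P true.

Lemma all_boolP {P : pred bool} : all_bool P -> forall a, P a.
Proof. by case/andP => ? ? []. Qed.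

(** Half of 6 and half of 4: together they give 3 + 2t = n / 2 for every t. *)
Definition balanced_line (f : nat -> bool) : bool :=
  all_bool (fun a => (head_sum (fun i => f i == a) == 3)
                  && (tail_sum (fun i => f i == a) == 2)).

Lemma bit_rows_balanced :
  all_below 5 (fun k => all_below 10 (fun i => balanced_line (bit k i))).
Proof. by vm_compute. Qed.

Lemma bit_cols_balanced :
  all_below 5 (fun k => all_below 10 (fun j => balanced_line (bit k ^~ j))).
Proof. by vm_compute. Qed.

Definition joint_ind (k l : nat) (a b : bool) (i j : nat) : nat :=
  (bit k i j == a) && (bit l i j == b).

(** The constants are a quarter of the block sizes 36, 24, 24 and 16, so that 9 + 6t + 6t + 4t^2 =
    n^2 / 4. *)
Lemma bit_pairs_balanced :
  all_below 5 (fun k => all_below 5 (fun l => (k != l) ==>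
    all_bool (fun a => all_bool (fun b =>
      [&& head_sum (fun i => head_sum (joint_ind k l a b i)) == 9,
          head_sum (fun i => tail_sum (joint_ind k l a b i)) == 6,
          tail_sum (fun i => head_sum (joint_ind k l a b i)) == 6
        & tail_sum (fun i => tail_sum (joint_ind k l a b i)) == 4])))).
Proof. by vm_compute. Qed.

Lemma bit_parity :
  all_below 10 (fun i => all_below 10 (fun j =>
    odd (sumn [seq nat_of_bool (bit k i j) | k <- iota 0 5])
      == row_class i (+) col_class j)).
Proof. by vm_compute. Qed.

Definition blowup (t k : nat) : 'M[bool]_(6 + 4 * t) :=
  \matrix_(r, c) bit k (code r) (code c).

Lemma card_set_sum (T : finType) (P : pred T) : #|[set x | P x]| = \sum_x P x.
Proof. by rewrite -sum1dep_card big_mkcond. Qed.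

Lemma balanced_line_card {t : nat} {f : nat -> bool} {a : bool} :
  balanced_line f ->
  #|[set i : 'I_(6 + 4 * t) | f (code i) == a]| = (6 + 4 * t) %/ 2.
Proof.
move=> /all_boolP /(_ a) /andP[/eqP f3 /eqP f2].
by rewrite card_set_sum (sum_code t (fun i => f i == a)) f3 f2; lia.
Qed.

Lemma blowup_frequency_square (t k : nat) :
  k < 5 -> frequency_square (blowup t k).
Proof.
move=> ltk5; split=> i a.
- have := all_belowP (all_belowP bit_rows_balanced ltk5) (code_lt i).
  by move/(@balanced_line_card t _ a) => <-; apply: eq_card => c; rewrite !inE mxE.
- have := all_belowP (all_belowP bit_cols_balanced ltk5) (code_lt i).
  by move/(@balanced_line_card t _ a) => <-; apply: eq_card => r; rewrite !inE mxE.
Qed.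

Lemma sum_code2 (t : nat) (f : nat -> nat -> nat) :
  \sum_(r < 6 + 4 * t) \sum_(c < 6 + 4 * t) f (code r) (code c) =
    head_sum (fun i => head_sum (f i)) + t * head_sum (fun i => tail_sum (f i))
    + t * (tail_sum (fun i => head_sum (f i))
           + t * tail_sum (fun i => tail_sum (f i))).
Proof.
have sumnD (g h : nat -> nat) s : sumn [seq g i + t * h i | i <- s] =
    sumn [seq g i | i <- s] + t * sumn [seq h i | i <- s].
  by elim: s => [|i s IHs] /=; rewrite ?IHs; lia.
under eq_bigr do rewrite sum_code.
by rewrite (sum_code t (fun i => head_sum (f i) + t * tail_sum (f i)))
  {1}/head_sum {2}/tail_sum !sumnD.
Qed.

Lemma blowup_orthogonal (t k l : nat) :
  k < 5 -> l < 5 -> k != l -> fs_orthogonal (blowup t k) (blowup t l).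
Proof.
move=> ltk5 ltl5 neqkl a b.
have /implyP/(_ neqkl) := all_belowP (all_belowP bit_pairs_balanced ltk5) ltl5.
move=> /all_boolP/(_ a)/all_boolP/(_ b)/and4P[/eqP hh /eqP ht /eqP th /eqP tt].
rewrite card_set_sum -(pair_bigA _ (fun r c =>
  nat_of_bool ((blowup t k r c == a) && (blowup t l r c == b)))) /=.
under eq_bigr do under eq_bigr do rewrite !mxE.
by rewrite (sum_code2 t (joint_ind k l a b)) hh ht th tt; lia.
Qed.

Lemma odd_sum (I : finType) (f g : I -> nat) :
  (forall i, odd (f i) = odd (g i)) -> odd (\sum_i f i) = odd (\sum_i g i).
Proof.
by move=> fg; apply: (big_ind2 (fun x y => odd x = odd y)) => // x y x' y' e e';
  rewrite !oddD e e'.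
Qed.

Lemma blowup_maximal (t : nat) (G : 'M[bool]_(6 + 4 * t)) :
  frequency_square G ->
  ~ (forall k, k < 5 -> fs_orthogonal (blowup t k) G).
Proof.
move=> [Grow Gcol] orthG.
have rowG r : \sum_c (G r c : nat) = 3 + 2 * t.
  have := Grow r true; rewrite card_set_sum; under eq_bigr do rewrite eqb_id.
  by move=> ->; lia.
have colG c : \sum_r (G r c : nat) = 3 + 2 * t.
  have := Gcol c true; rewrite card_set_sum; under eq_bigr do rewrite eqb_id.
  by move=> ->; lia.
pose w r c := sumn [seq nat_of_bool (bit k (code r) (code c)) | k <- iota 0 5].
have wsum : \sum_(r < 6 + 4 * t) \sum_(c < 6 + 4 * t) w r c * G r c
    = 5 * (9 + 12 * t + 4 * t ^ 2).
  (* By orthogonality, the [k]-th square and [G] share a one in exactly n^2 / 4 cells; this number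
     is odd. *)
  have part k : k < 5 -> \sum_(r < 6 + 4 * t) \sum_(c < 6 + 4 * t)
      (bit k (code r) (code c) * G r c) = 9 + 12 * t + 4 * t ^ 2.
    move=> ltk5; transitivity ((6 + 4 * t) ^ 2 %/ 4); last by lia.
    rewrite -(orthG k ltk5 true true) card_set_sum.
    rewrite -(pair_bigA _ (fun r c =>
      nat_of_bool ((blowup t k r c == true) && (G r c == true)))) /=.
    by apply: eq_bigr => r _; apply: eq_bigr => c _; rewrite mxE !eqb_id mulnb.
  (* Expand the weight and move the sum over the five squares outermost. *)
  under eq_bigr => r _ do under eq_bigr => c _ do
    rewrite /w sumnE big_map big_distrl /=.
  under eq_bigr do rewrite exchange_big /=.
  rewrite exchange_big /= !big_cons big_nil !part //; lia.
(* An integer sum of indicators replaces the exclusive or: the parity is the same, and the sum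
   splits into a row part and a column part. *)
have parity_sum : \sum_(r < 6 + 4 * t) \sum_(c < 6 + 4 * t)
      (row_class (code r) + col_class (code c)) * G r c
    = (\sum_(r < 6 + 4 * t) row_class (code r)
       + \sum_(c < 6 + 4 * t) col_class (code c)) * (3 + 2 * t).
  under eq_bigr => r _.
    under eq_bigr do rewrite mulnDl.
    rewrite big_split -big_distrr /= rowG; over.
  rewrite big_split mulnDl !big_distrl /=; congr (_ + _).
  by rewrite exchange_big; apply: eq_bigr => c _; rewrite -big_distrr /= colG.
have : odd (\sum_(r < 6 + 4 * t) \sum_(c < 6 + 4 * t) w r c * G r c)
  = odd (\sum_(r < 6 + 4 * t) \sum_(c < 6 + 4 * t)
      (row_class (code r) + col_class (code c)) * G r c).
  apply: odd_sum => r; apply: odd_sum => c; rewrite !oddM oddD !oddb.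
  congr (_ && _); apply/eqP.
  exact: all_belowP (all_belowP bit_parity (code_lt r)) (code_lt c).
(* The left side is a product of odd numbers; on the right, |A| + |B| = 4 + 4t is even. *)
rewrite wsum parity_sum (sum_code t row_class) (sum_code t col_class).
by rewrite /head_sum /tail_sum /= !(oddM, oddD); case: (odd t).
Qed.

Theorem theorem7p1 (n : nat) (hn6 : 6 <= n) (hn : n = 2 %[mod 4]) :
  exists S : {set 'M[bool]_n}, maxMOFS 5 S.
Proof.
have [t ->] : exists t, n = 6 + 4 * t by exists ((n - 6) %/ 4); lia.
(* Needed for the set to have five members. Were two of the squares equal, no cell would carry the
   pair (1, 0), whereas orthogonality demands n^2 / 4 > 0 such cells. *)
have blowup_inj : injective (fun k : 'I_5 => blowup t k).
  move=> k l /= eqkl; apply/val_inj/eqP/negPn/negP => neqkl.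
  have := blowup_orthogonal t _ _ (ltn_ord k) (ltn_ord l) neqkl true false.
  rewrite eqkl (_ : [set _ | _] = set0) ?cards0; first by lia.
  by apply/setP => rc; rewrite !inE; case: (blowup t l _ _).
exists [set blowup t (k : 'I_5) | k : 'I_5]; split; first split.
- by rewrite card_imset // card_ord.
- by move=> _ /imsetP[k _ ->]; apply: blowup_frequency_square.
- move=> _ _ /imsetP[k _ ->] /imsetP[l _ ->] neqkl.
  by apply: blowup_orthogonal => //; apply: contra_notN neqkl => /eqP ->.
- case=> G [freqG orthG]; apply: (blowup_maximal t G freqG) => k ltk5.
  by apply: orthG; apply/imsetP; exists (Ordinal ltk5).
Qed.
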